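(* The quasiregular representation of $T$ on $\ell^2(T/\vec T)$ is irreducible.
   Context: $T$ is regarded as a discrete group. The quasiregular representation is the unitary representation of $T$ on the complex Hilbert space $\ell^2(T/\vec T)$ induced by the action of $T$ by translation on the coset space $T/\vec T$. Irreducible means there are no closed invariant subspaces other than $0$ and the whole space. **Trees and $T$.** A full binary tree is a finite rooted plane tree in which every vertex has either $0$ children or $2$ children (a left and a right one); leaves are numbered $1,2,\dots$ from left to right. Associate $[0,1)$ with the root, and if $[a,b)$ is associated with a vertex, associate $[a,\frac{a+b}2)$ with its left child and $[\frac{a+b}2,b)$ with its right child. Given full binary trees $R,S$ with the same number $m$ of leaves and $1\le n\le m$, the triple $(R,S,n)$ represents the homeomorphism of the circle $[0,1]/(0\sim 1)$ which, for each $i$, maps the interval of leaf $i$ of $R$ affinely and increasingly onto the interval of leaf $i+n-1$ (taken mod $m$ in $\{1,\dots,m\}$) of $S$; leaf $i$ of $R$ is said to be identified with leaf $i+n-1$ of $S$. Thompson's group $T$ is the group of all homeomorphisms so represented. A triple is reduced if there is no caret in $R$ both of whose children are leaves that are identified (left with left, right with right) with the two leaf children of a caret of $S$; every element of $T$ has a unique reduced triple. **Thompson graphs.** For a full binary tree with leaves $l_1,\dots,l_m$ arranged on a horizontal line, its Thompson graph has vertices $v_1,\dots,v_m$ on that line, $v_1$ to the left of $l_1$ and $v_i$ between $l_{i-1}$ and $l_i$; for each left edge $e$ of the tree, the unique pair $v_i,v_j$ that can be joined by a path above the line crossing the tree only at $e$ is joined by an edge. (Equivalently: for each non-leaf vertex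 $p$, join $v_i$ to $v_j$ where $l_i$ is the leftmost leaf below the left child of $p$ and $l_j$ is the leftmost leaf below the right child of $p$.) The Thompson graph of $f\in T$ with reduced triple $(R,S,n)$ is obtained from the Thompson graphs of $R$ and $S$ by identifying their vertices in the same way as the leaves (the $i$th vertex for $R$ with the $(i+n-1)$st, mod $m$, for $S$). $\vec T$ is the subgroup of all $f\in T$ whose Thompson graph is bipartite. *)

(* Defs.v *)
From HB Require Import structures.
From mathcomp Require Import all_boot all_order all_algebra.
From mathcomp Require Import all_classical all_reals all_analysis.
From mathcomp Require Import complex zify ring lra.

Set Implicit Arguments.
Unset Strict Implicit.
Unset Printing Implicit Defensive.

Import Order.TTheory GRing.Theory Num.Theory.
Import numFieldNormedType.Exports.

Local Open Scope classical_set_scope.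
Local Open Scope ring_scope.

Inductive btree := Leaf | Node of btree & btree.

Fixpoint nleaves (t : btree) : nat :=
  if t is Node l r then (nleaves l + nleaves r)%N else 1%N.

(* Leaves are numbered from 0, whereas the shift [n] of a triple is the usual
   1-based one: the [i.+1]-st leaf of the source goes to the [i + n]-th leaf of
   the target, modulo [m] in {1, ..., m}. *)
Definition ident (m n i : nat) : nat := ((i + n.-1) %% m)%N.

Definition triple_ok (U V : btree) (n : nat) : Prop :=
  nleaves U = nleaves V /\ (1 <= n <= nleaves U)%N.

(* [caret_leaves t k]: the numbers of the left leaves of the carets of [t] whose
   two children are both leaves, when the leaves of [t] are numbered from [k]. *)
Fixpoint caret_leaves (t : btree) (k : nat) : seq nat :=
  match t with
  | Leaf => [::]
  | Node Leaf Leaf => [:: k]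
  | Node l r => caret_leaves l k ++ caret_leaves r (k + nleaves l)%N
  end.

Definition reduced (U V : btree) (n : nat) : Prop :=
  ~ exists i j, [/\ i \in caret_leaves U 0%N, j \in caret_leaves V 0%N,
      ident (nleaves U) n i = j & ident (nleaves U) n i.+1 = j.+1].

(* Vertex [i] of the Thompson graph is the one immediately to the left of leaf
   [i]. Each inner vertex of the tree joins the leftmost leaves below its two
   children, here [k] and [k + nleaves l]. *)
Fixpoint tree_edges (t : btree) (k : nat) : seq (nat * nat) :=
  if t is Node l r then
    (k, (k + nleaves l)%N) :: tree_edges l k ++ tree_edges r (k + nleaves l)%N
  else [::].

Definition tree_adj (t : btree) (i j : nat) : bool :=
  ((i, j) \in tree_edges t 0%N) || ((j, i) \in tree_edges t 0%N).

(* The vertices of the graph of [V] are named through the identification, which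
   is a bijection of [0, nleaves U) whenever [triple_ok U V n] holds. *)
Definition thompson_graph (U V : btree) (n : nat) : rel 'I_(nleaves U) :=
  fun i j => tree_adj U i j
    || tree_adj V (ident (nleaves U) n i) (ident (nleaves U) n j).
Arguments thompson_graph U V n : clear implicits.

Definition bipartite (X : finType) (e : rel X) : Prop :=
  exists c : X -> bool, forall x y, e x y -> c x != c y.

Section Circle.
Variable R : realType.
Implicit Types (a b : R) (p q : R * R) (t U V : btree).

(* The circle [0, 1] / (0 ~ 1), each point being given by its representative in
   [0, 1). *)
Record circle := Circle { cpoint :> R; cpointP : 0 <= cpoint < 1 }.
HB.instance Definition _ := [isSub for cpoint].
HB.instance Definition _ := [Choice of circle by <:].

Fixpoint leaf_intervals (t : btree) (p : R * R) : seq (R * R) :=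
  if t is Node l r then
    leaf_intervals l (p.1, (p.1 + p.2) / 2)
      ++ leaf_intervals r ((p.1 + p.2) / 2, p.2)
  else [:: p].

Definition leaf_interval (t : btree) (i : nat) : R * R :=
  nth (0, 0) (leaf_intervals t (0, 1)) i.

Definition in_interval p (x : R) : bool := p.1 <= x < p.2.

Definition affine p q (x : R) : R :=
  q.1 + (x - p.1) * (q.2 - q.1) / (p.2 - p.1).

(* The leaf intervals partition [0, 1), so these equations determine [f] (which
   exists by [represents_ex]) and make it a homeomorphism of the circle. *)
Definition represents (U V : btree) (n : nat) (f : circle -> circle) : Prop :=
  triple_ok U V n /\
  forall i, (i < nleaves U)%N ->
  forall x : circle, in_interval (leaf_interval U i) x ->
    f x = affine (leaf_interval U i)
                 (leaf_interval V (ident (nleaves U) n i)) x :> R.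

Definition in_T (f : circle -> circle) : Prop :=
  exists U V n, represents U V n f.

Lemma size_leaf_intervals t p : size (leaf_intervals t p) = nleaves t.
Proof. by elim: t p => //= l IHl r IHr p; rewrite size_cat IHl IHr. Qed.

Lemma nleaves_gt0 t : (0 < nleaves t)%N.
Proof. by elim: t => //= l IHl r IHr; rewrite addn_gt0 IHl. Qed.

Lemma count_leaf_intervals t p (x : R) : p.1 < p.2 ->
  count (in_interval^~ x) (leaf_intervals t p) = in_interval p x.
Proof.
elim: t p => [|l IHl r IHr] p pP /=; first by rewrite addn0.
rewrite count_cat IHl /=; last by lra.
rewrite IHr /=; last by lra.
rewrite /in_interval /=.
case: (ltP x ((p.1 + p.2) / 2)) => h.
  have -> : x < p.2 by lra.
  by rewrite !andbT addn0.
have -> : p.1 <= x by lra.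
by rewrite andbF add0n.
Qed.

Lemma leaf_intervals_sub t p q : p.1 < p.2 -> q \in leaf_intervals t p ->
  [/\ p.1 <= q.1, q.1 < q.2 & q.2 <= p.2].
Proof.
elim: t p => [|l IHl r IHr] p pP /=.
  by rewrite inE => /eqP ->; rewrite pP !lexx.
rewrite mem_cat => /orP[/IHl|/IHr] /= []; try by lra.
- by move=> h1 h2 h3; split=> //; lra.
- by move=> h1 h2 h3; split=> //; lra.
Qed.

Lemma affine_in p q (x : R) : p.1 < p.2 -> q.1 < q.2 ->
  in_interval p x -> in_interval q (affine p q x).
Proof.
move=> hp hq /andP[h1 h2]; rewrite /in_interval /affine.
set d := (x - p.1) * (q.2 - q.1) / (p.2 - p.1).
have d0 : 0 <= d by rewrite /d !mulr_ge0 ?invr_ge0 //; lra.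
have d1 : d < q.2 - q.1.
  rewrite /d ltr_pdivrMr; last by lra.
  by rewrite (mulrC (q.2 - q.1)) ltr_pM2r; lra.
by apply/andP; split; lra.
Qed.

Lemma affine_id p (x : R) : p.1 < p.2 -> affine p p x = x.
Proof. by move=> hp; rewrite /affine; field; lra. Qed.

Lemma affine_comp p q s (x : R) : p.1 < p.2 -> q.1 < q.2 ->
  affine q s (affine p q x) = affine p s x.
Proof. by move=> hp hq; rewrite /affine; field; apply/andP; split; lra. Qed.

Definition sends (f : circle -> circle) (pq : (R * R) * (R * R)) : Prop :=
  forall x : circle, in_interval pq.1 x -> f x = affine pq.1 pq.2 x :> R.

Definition z2 : (R * R) * (R * R) := ((0, 0), (0, 0)).

Definition matches f I J :=
  size I = size J /\ forall pq, pq \in zip I J -> sends f pq.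

Lemma nth_rot_mod (T : Type) (x0 : T) (s : seq T) k i :
  (k <= size s)%N -> (i < size s)%N ->
  nth x0 (rot k s) i = nth x0 s ((i + k) %% size s)%N.
Proof.
move=> ks ilt; rewrite /rot nth_cat size_drop; case: ifP => h.
  by rewrite nth_drop addnC modn_small //; lia.
have -> : (i + k = (i - (size s - k)) + size s)%N by lia.
by rewrite modnDr modn_small ?nth_take //; lia.
Qed.

Lemma representsE U V n f : represents U V n f <->
  triple_ok U V n /\
  matches f (leaf_intervals U (0, 1)) (rot n.-1 (leaf_intervals V (0, 1))).
Proof.
split=> -[ok H]; split=> //; have [e /andP[n0 nU]] := ok.
  split; first by rewrite size_rot !size_leaf_intervals.
  have nV : (n.-1 <= nleaves V)%N by rewrite -e (leq_trans (leq_pred n)).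
  move=> pq pqI; have [ i ] := nthP z2 pqI; rewrite size_zip size_rot.
  rewrite !size_leaf_intervals -e minnn => iU <-.
  rewrite nth_zip ?size_rot ?size_leaf_intervals // nth_rot_mod;
    rewrite ?size_leaf_intervals -?e // e //.
  move=> x /= xi; rewrite (H i iU x xi) /leaf_interval /ident.
  by rewrite e.
move=> i iU x xi; case: H => sIJ H.
have nV : (n.-1 <= nleaves V)%N by rewrite -e (leq_trans (leq_pred n)).
have := H (nth z2 (zip (leaf_intervals U (0, 1))
   (rot n.-1 (leaf_intervals V (0, 1)))) i).
rewrite nth_zip // nth_rot_mod ?size_leaf_intervals -?e // e //; apply=> //.
apply/(nthP z2); exists i.
  by rewrite size_zip -sIJ minnn size_leaf_intervals.
rewrite nth_zip // nth_rot_mod ?size_leaf_intervals -?e // e //.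
Qed.

Lemma matches_cat f I J I' J' :
  matches f I J -> matches f I' J' -> matches f (I ++ I') (J ++ J').
Proof.
move=> [s H] [s' H']; split; first by rewrite !size_cat s s'.
by move=> pq; rewrite zip_cat // mem_cat => /orP[/H|/H'].
Qed.

Lemma matches_subdiv f t p q : p.1 < p.2 -> q.1 < q.2 -> sends f (p, q) ->
  matches f (leaf_intervals t p) (leaf_intervals t q).
Proof.
elim: t p q => [|l IHl r IHr] p q hp hq h /=.
  by split=> // pq; rewrite inE => /eqP ->.
apply: matches_cat; [apply: IHl|apply: IHr] => /=; try lra.
  move=> x /= /andP[/= x1 x2].
  rewrite (h x) /=; last by rewrite /in_interval; lra.
  by rewrite /affine /=; field; rewrite -?mulr2n; lra.
move=> x /= /andP[/= x1 x2].
rewrite (h x) /=; last by rewrite /in_interval; lra.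
by rewrite /affine /=; field; lra.
Qed.

(* Hangs the [i]-th tree of [ts] at leaf [i] of [t]. *)
Fixpoint graft (t : btree) (ts : seq btree) : btree :=
  if t is Node l r then
    Node (graft l (take (nleaves l) ts)) (graft r (drop (nleaves l) ts))
  else head Leaf ts.

Definition blocks (ts : seq btree) (I : seq (R * R)) : seq (seq (R * R)) :=
  [seq leaf_intervals x.1 x.2 | x <- zip ts I].

Lemma leaf_intervals_graft t ts p : size ts = nleaves t ->
  leaf_intervals (graft t ts) p = flatten (blocks ts (leaf_intervals t p)).
Proof.
elim: t ts p => [|l IHl r IHr] ts p /=.
  by case: ts => // u [] //= _; rewrite cats0.
move=> sz.
have sl : size (take (nleaves l) ts) = nleaves l.
  by rewrite size_takel // sz leq_addr.
rewrite IHl // IHr; last by rewrite size_drop sz addKn.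
rewrite -flatten_cat /blocks -map_cat -zip_cat ?cat_take_drop //.
by rewrite sl size_leaf_intervals.
Qed.

Lemma flatten_rot (T : Type) (ss : seq (seq T)) k :
  flatten (rot k ss) = rot (size (flatten (take k ss))) (flatten ss).
Proof.
have e : flatten ss = flatten (take k ss) ++ flatten (drop k ss).
  by rewrite -flatten_cat cat_take_drop.
by rewrite /rot flatten_cat e drop_size_cat ?take_size_cat.
Qed.

Lemma zip_rot (S T : Type) (s : seq S) (t : seq T) k : size s = size t ->
  zip (rot k s) (rot k t) = rot k (zip s t).
Proof.
move=> e; rewrite -[in RHS](cat_take_drop k s) -[in RHS](cat_take_drop k t).
have e1 : size (take k s) = size (take k t) by rewrite !size_take e.
have e2 : size (drop k s) = size (drop k t) by rewrite !size_drop e.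
rewrite zip_cat // /rot.
case: (leqP k (size s)) => h.
  have sz : size (zip (take k s) (take k t)) = k.
    by rewrite size_zip -e1 minnn size_takel.
  by rewrite zip_cat // drop_size_cat // take_size_cat.
have h' := ltnW h.
rewrite (drop_oversize h') take_oversize // drop_oversize -?e //.
rewrite take_oversize -?e // !cats0 /= take_oversize ?drop_oversize //;
by rewrite size_zip -e minnn.
Qed.

Lemma matches_flatten f (ts : seq btree) I J :
  size I = size J -> size ts = size I ->
  {in I, forall p, p.1 < p.2} -> {in J, forall p, p.1 < p.2} ->
  matches f I J -> matches f (flatten (blocks ts I)) (flatten (blocks ts J)).
Proof.
elim: ts I J => [|t ts IH] [|p I] [|q J] //= [eIJ] [et] hI hJ [_ H].
apply: matches_cat.
  apply: matches_subdiv; first by apply: hI; rewrite mem_head.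
    by apply: hJ; rewrite mem_head.
  by apply: H; rewrite mem_head.
apply: IH => //.
- by move=> x xI; apply: hI; rewrite inE xI orbT.
- by move=> x xI; apply: hJ; rewrite inE xI orbT.
- by split=> // pq h; apply: H; rewrite inE h orbT.
Qed.

Lemma leaf_intervals01 t p : p \in leaf_intervals t (0, 1) -> p.1 < p.2.
Proof. by case/leaf_intervals_sub => //=; exact: ltr01. Qed.

Lemma rot_range (T : Type) (s : seq T) k : (0 < size s)%N ->
  exists2 n, (1 <= n <= size s)%N & rot k s = rot n.-1 s.
Proof.
move=> s0; case: (ltnP k (size s)) => h; first by exists k.+1.
by exists 1%N; rewrite ?s0 // rot0 rot_oversize.
Qed.

Lemma represents_graft U V n f ts : size ts = nleaves U ->
  represents U V n f ->
  exists n', represents (graft U (rot n.-1 ts)) (graft V ts) n' f.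
Proof.
move=> sts /representsE[[e /andP[n0 nU]] M].
set I := leaf_intervals U (0, 1) in M; set J := leaf_intervals V (0, 1) in M.
have sI : size I = nleaves U by rewrite size_leaf_intervals.
have sJ : size J = nleaves U by rewrite size_leaf_intervals.
have hI : leaf_intervals (graft U (rot n.-1 ts)) (0, 1) =
    flatten (blocks (rot n.-1 ts) I).
  by rewrite leaf_intervals_graft ?size_rot.
have hJ : leaf_intervals (graft V ts) (0, 1) = flatten (blocks ts J).
  by rewrite leaf_intervals_graft ?sts.
have M' : matches f (flatten (blocks (rot n.-1 ts) I))
                    (flatten (blocks (rot n.-1 ts) (rot n.-1 J))).
  apply: matches_flatten => //; rewrite ?size_rot ?sI ?sJ //.
  - by move=> p; exact: leaf_intervals01.
  - by move=> p; rewrite mem_rot; exact: leaf_intervals01.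
have E : flatten (blocks (rot n.-1 ts) (rot n.-1 J)) =
    rot (size (flatten (take n.-1 (blocks ts J)))) (flatten (blocks ts J)).
  by rewrite -flatten_rot /blocks zip_rot ?map_rot ?sJ.
move: M'; rewrite E => M'.
have [|n' hn' rn'] := @rot_range _ (flatten (blocks ts J))
    (size (flatten (take n.-1 (blocks ts J)))).
  by rewrite -hJ size_leaf_intervals nleaves_gt0.
exists n'; apply/representsE; split; last by rewrite hI hJ -rn'.
have e' : nleaves (graft U (rot n.-1 ts)) = nleaves (graft V ts).
  rewrite -(size_leaf_intervals _ (0, 1)) hI -(size_leaf_intervals _ (0, 1)) hJ.
  by case: M' => ->; rewrite size_rot.
by split=> //; rewrite e' -(size_leaf_intervals _ (0, 1)) hJ.
Qed.

Lemma common_refinement U V : exists ts us,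
  [/\ size ts = nleaves U, size us = nleaves V & graft U ts = graft V us].
Proof.
elim: U V => [|l IHl r IHr] V.
  exists [:: V], (nseq (nleaves V) Leaf); split=> //=; rewrite ?size_nseq //.
  elim: V => //= l IHl r IHr.
  by rewrite take_nseq ?leq_addr // drop_nseq addKn -IHl -IHr.
case: V => [|l' r'].
  exists (nseq (nleaves (Node l r)) Leaf), [:: Node l r].
  split=> //=; rewrite ?size_nseq //.
  have H t : graft t (nseq (nleaves t) Leaf) = t.
    elim: t => //= l1 IHl1 r1 IHr1.
    by rewrite take_nseq ?leq_addr // drop_nseq addKn IHl1 IHr1.
  by rewrite take_nseq ?leq_addr // drop_nseq addKn !H.
have [ts [us [s1 s2 e]]] := IHl l'; have [ts' [us' [s1' s2' e']]] := IHr r'.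
exists (ts ++ ts'), (us ++ us'); split=> /=; rewrite ?size_cat ?s1 ?s2 ?s1' ?s2' //.
by rewrite !take_size_cat // !drop_size_cat // e e'.
Qed.

Lemma matches_comp f g I J K : {in I, forall p, p.1 < p.2} ->
  {in J, forall p, p.1 < p.2} ->
  matches f I J -> matches g J K -> matches (g \o f) I K.
Proof.
move=> hI hJ [sIJ HIJ] [sJK HJK]; split; first by rewrite sIJ.
move=> pq pqI; have [ i ] := nthP z2 pqI; rewrite size_zip -sJK -sIJ minnn => iI.
rewrite nth_zip ?sIJ // => <- x /= xi.
have iJ : (i < size J)%N by rewrite -sIJ.
have memI := mem_nth (0, 0) iI; have memJ := mem_nth (0, 0) iJ.
have fx : f x = affine (nth (0, 0) I i) (nth (0, 0) J i) x :> R.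
  apply: (HIJ (nth (0, 0) I i, nth (0, 0) J i)) => //.
  rewrite -nth_zip //; apply: mem_nth; by rewrite size_zip -sIJ minnn.
have xJ : in_interval (nth (0, 0) J i) (f x).
  by rewrite fx; apply: affine_in => //; [exact: hI|exact: hJ].
rewrite (HJK (nth (0, 0) J i, nth (0, 0) K i)) //=; last first.
  rewrite -nth_zip //; apply: mem_nth; by rewrite size_zip -sJK minnn.
by rewrite fx affine_comp //; [exact: hI|exact: hJ].
Qed.

Lemma matches_rot f I J k : matches f I J -> matches f (rot k I) (rot k J).
Proof.
move=> [s H]; split; first by rewrite !size_rot.
by move=> pq; rewrite zip_rot // mem_rot; exact: H.
Qed.

Lemma in_T_comp f g : in_T f -> in_T g -> in_T (g \o f).
Proof.
move=> [U [V [n rf]]] [V' [W [k rg]]].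
have [ts [us [sts sus e]]] := common_refinement V V'.
have [[eUV _] _] := rf; have [[eVW /andP[_ kV']] _] := rg.
have [|n' rf'] := represents_graft _ rf (ts := ts); first by rewrite eUV.
have [|k' rg'] := represents_graft _ rg (ts := rotr k.-1 us).
  by rewrite size_rotr.
move: rg'; rewrite rotrK -e => rg'.
set U' := graft U _ in rf'; set W' := graft W _ in rg'.
set X := graft V ts in rf' rg'.
have /representsE[[eU' hn'] Mf] := rf'; have /representsE[[eX hk'] Mg] := rg'.
have M : matches (g \o f) (leaf_intervals U' (0, 1))
  (rot n'.-1 (rot k'.-1 (leaf_intervals W' (0, 1)))).
  apply: matches_comp (matches_rot _ Mg) => //.
  - by move=> p; exact: leaf_intervals01.
  - by move=> p; rewrite mem_rot; exact: leaf_intervals01.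
have sW : size (leaf_intervals W' (0, 1)) = nleaves W'.
  by rewrite size_leaf_intervals.
move: M; rewrite rot_add_mod ?sW; last first.
- by rewrite -eX -eU'; case/andP: hn' => _; apply: leq_trans; exact: leq_pred.
- by rewrite -eX; case/andP: hk' => _; apply: leq_trans; exact: leq_pred.
move=> M.
have [|j hj rj] := @rot_range _ (leaf_intervals W' (0, 1))
    (if n'.-1 + k'.-1 <= nleaves W' then n'.-1 + k'.-1
     else n'.-1 + k'.-1 - nleaves W')%N.
  by rewrite sW nleaves_gt0.
exists U', W', j; apply/representsE; split; last by rewrite -rj.
by split; rewrite eU' eX // -sW.
Qed.

Lemma represents_id U f : represents U U 1 f -> f = id.
Proof.
move=> [[_ h] H]; apply/funext => x; apply/val_inj => /=.
have : has (in_interval^~ x) (leaf_intervals U (0, 1)).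
  by rewrite has_count count_leaf_intervals ?ltr01 // /in_interval cpointP.
case/(has_nthP (0, 0)) => i; rewrite size_leaf_intervals => iU xi.
rewrite (H i iU x xi) /ident addn0 modn_small // affine_id //.
by apply: (leaf_intervals01 (t := U)); rewrite mem_nth ?size_leaf_intervals.
Qed.

Lemma in_T_id : in_T id.
Proof.
exists Leaf, Leaf, 1%N; split=> // -[] // _ x _.
by rewrite /leaf_interval /= affine_id //= ltr01.
Qed.

Lemma count1_find (T : Type) (x0 : T) (P : pred T) s i :
  count P s = 1%N -> (i < size s)%N -> P (nth x0 s i) -> find P s = i.
Proof.
move=> c1 h Pi.
have : count P (take i s) = 0%N.
  move: c1; rewrite -(cat_take_drop i s) count_cat (drop_nth x0) //= Pi.
  by rewrite take_size_cat ?size_takel 1?ltnW //; lia.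
move/eqP; rewrite -leqn0 leqNgt -has_count => nh.
rewrite -(cat_take_drop i s) find_cat (negbTE nh) (drop_nth x0) //= Pi.
by rewrite size_takel ?addn0 // ltnW.
Qed.

Lemma represents_ex U V n : triple_ok U V n -> exists f, represents U V n f.
Proof.
move=> ok; have [e /andP[n0 nU]] := ok.
pose idx (x : circle) := find (in_interval^~ x) (leaf_intervals U (0, 1)).
have idxP (x : circle) : (idx x < nleaves U)%N /\
    in_interval (leaf_interval U (idx x)) x.
  have hx : has (in_interval^~ x) (leaf_intervals U (0, 1)).
    by rewrite has_count count_leaf_intervals ?ltr01 // /in_interval cpointP.
  split; first by rewrite /idx -(size_leaf_intervals U (0, 1)) -has_find.
  exact: (nth_find (0, 0) hx).
pose F (x : circle) := affine (leaf_interval U (idx x))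
  (leaf_interval V (ident (nleaves U) n (idx x))) x.
have FP x : 0 <= F x < 1.
  have [h1 h2] := idxP x.
  have memU : leaf_interval U (idx x) \in leaf_intervals U (0, 1).
    by rewrite mem_nth // size_leaf_intervals.
  have memV : leaf_interval V (ident (nleaves U) n (idx x))
      \in leaf_intervals V (0, 1).
    by rewrite mem_nth // size_leaf_intervals -e ltn_mod nleaves_gt0.
  have := affine_in (leaf_intervals01 memU) (leaf_intervals01 memV) h2.
  have [] := leaf_intervals_sub _ memV => /=; first exact: ltr01.
  by rewrite /in_interval -/(F x); lra.
exists (fun x => Circle (FP x)); split=> // i iU x xi /=.
suff -> : i = idx x by [].
apply/esym/(count1_find (x0 := (0, 0))); rewrite ?size_leaf_intervals //.
by rewrite count_leaf_intervals ?ltr01 // /in_interval cpointP.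
Qed.

Lemma in_T_inv f : in_T f -> exists g, [/\ in_T g, cancel f g & cancel g f].
Proof.
move=> [U [V [n rf]]]; have /representsE[[e /andP[n0 nU]] Mf] := rf.
set I := leaf_intervals U (0, 1) in Mf; set J := leaf_intervals V (0, 1) in Mf.
have sI : size I = nleaves U by rewrite size_leaf_intervals.
have sJ : size J = nleaves U by rewrite size_leaf_intervals.
have hI : {in I, forall p, p.1 < p.2} by move=> p; exact: leaf_intervals01.
have hJ : {in J, forall p, p.1 < p.2} by move=> p; exact: leaf_intervals01.
have [|k hk rk] := @rot_range _ I (nleaves U - n.-1).
  by rewrite sI nleaves_gt0.
have [|g rg] := @represents_ex V U k; first by split; rewrite -?e -?sI.
have /representsE[_ Mg] := rg.
have Mg' : matches g (rot n.-1 J) I.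
  have := matches_rot n.-1 Mg; rewrite -/I -/J -rk.
  suff -> : rot n.-1 (rot (nleaves U - n.-1) I) = I by [].
  by rewrite -sI; exact: rotrK.
have e1 : g \o f = id.
  apply: (@represents_id U); apply/representsE; rewrite rot0; split.
    by split=> //; rewrite nleaves_gt0.
  by apply: matches_comp Mg' => // p; rewrite mem_rot; exact: hJ.
have e2 : f \o g = id.
  apply: (@represents_id V); apply/representsE; rewrite rot0; split.
    by split=> //; rewrite nleaves_gt0.
  have : matches (f \o g) (rot n.-1 J) (rot n.-1 J).
    by apply: matches_comp Mf => // p; rewrite mem_rot; exact: hJ.
  have eJ : rot (size J - n.-1) (rot n.-1 J) = J.
    by rewrite -(size_rot n.-1 J); exact: rotK.
  by move/(matches_rot (size J - n.-1)); rewrite !eJ.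
exists g; split; first by exists V, U, k.
  by move=> x; rewrite -[LHS]/((g \o f) x) e1.
by move=> x; rewrite -[LHS]/((f \o g) x) e2.
Qed.

End Circle.

Section ThompsonGroup.
Variable R : realType.

Record thompson := Thompson {
  homeo :> circle R -> circle R;
  homeoP : `[< in_T homeo >] }.

HB.instance Definition _ := [isSub for homeo].
HB.instance Definition _ := [Choice of thompson by <:].

Lemma thompson_in_T (f : thompson) : in_T f.
Proof. exact/asboolP/homeoP. Qed.

Definition thompson_one : thompson := Thompson (asboolT (@in_T_id R)).

(* The product is composition: [(g * f) x = g (f x)]. *)
Definition thompson_mul (g f : thompson) : thompson :=
  Thompson (asboolT (in_T_comp (thompson_in_T f) (thompson_in_T g))).

Definition thompson_inv_fun (f : thompson) : circle R -> circle R :=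
  sval (cid (in_T_inv (thompson_in_T f))).

Lemma thompson_inv_funP (f : thompson) :
  [/\ in_T (thompson_inv_fun f), cancel f (thompson_inv_fun f)
    & cancel (thompson_inv_fun f) f].
Proof. exact: svalP (cid (in_T_inv (thompson_in_T f))). Qed.

Lemma thompson_inv_subproof (f : thompson) : in_T (thompson_inv_fun f).
Proof. by have [] := thompson_inv_funP f. Qed.

Definition thompson_inv (f : thompson) : thompson :=
  Thompson (asboolT (thompson_inv_subproof f)).

Lemma thompson_mulA : associative thompson_mul.
Proof. by move=> h g f; apply/val_inj. Qed.

Lemma thompson_mul1g : left_id thompson_one thompson_mul.
Proof. by move=> f; apply/val_inj. Qed.

Lemma thompson_mulg1 : right_id thompson_one thompson_mul.
Proof. by move=> f; apply/val_inj. Qed.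

Lemma thompson_mulVg : left_inverse thompson_one thompson_inv thompson_mul.
Proof.
move=> f; apply/val_inj/funext => x /=.
by have [_ fK _] := thompson_inv_funP f; exact: fK.
Qed.

Lemma thompson_mulgV : right_inverse thompson_one thompson_inv thompson_mul.
Proof.
move=> f; apply/val_inj/funext => x /=.
by have [_ _ Kf] := thompson_inv_funP f; exact: Kf.
Qed.

HB.instance Definition _ := isGroup.Build thompson thompson_mulA
  thompson_mul1g thompson_mulg1 thompson_mulVg thompson_mulgV.

End ThompsonGroup.

(* Jones' subgroup. Each element of Thompson's group has exactly one reduced
   triple, so the existential quantifier ranges over that triple only. *)
Definition vecT (R : realType) : set (thompson R) :=
  [set f | exists U V n, [/\ represents U V n f, reduced U V n
                           & bipartite (thompson_graph U V n)]].
Arguments vecT R : clear implicits.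

Section CosetSpace.
Local Open Scope group_scope.
Variables (G : groupType) (H : set G).

(* The left cosets [g H], as subsets of [G]; for a subgroup [H] this is G / H. *)
Definition coset_set : set (set G) := [set (fun h => g * h) @` H | g in setT].

Definition coset_space : Type := set_type coset_set.
HB.instance Definition _ := Choice.on coset_space.

Lemma translate_subproof (g : G) (C : coset_space) :
  (fun h => g * h) @` sval C \in coset_set.
Proof.
case: C => C /= /[!inE] -[a _ <-]; exists (g * a) => //.
apply/seteqP; split=> [_ [h Hh <-]|_ [_ [h Hh <-] <-]].
  by exists (a * h); [exists h|rewrite mulgA].
by exists h => //; rewrite mulgA.
Qed.

Definition translate (g : G) (C : coset_space) : coset_space :=
  exist (fun D => D \in coset_set) _ (translate_subproof g C).

Lemma translate1 C : translate 1 C = C.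
Proof.
apply/val_inj/seteqP; split=> [_ [h Hh <-]|h Hh] /=; first by rewrite mul1g.
by exists h => //; rewrite mul1g.
Qed.

Lemma translateM g g' C : translate (g * g') C = translate g (translate g' C).
Proof.
apply/val_inj/seteqP; split=> [_ [h Hh <-]|_ [_ [h Hh <-] <-]] /=.
  by exists (g' * h); [exists h|rewrite mulgA].
by exists h => //; rewrite mulgA.
Qed.

End CosetSpace.

Section L2.
Variables (R : realType) (X : choiceType).
Implicit Types f g : X -> R[i].
Local Notation normc := Normc.normc.

Definition sqnorm f : \bar R :=
  (\esum_(x in [set: X]) ((normc (f x)) ^+ 2)%:E)%E.

Definition square_summable : pred (X -> R[i]) := fun f => (sqnorm f < +oo)%E.

Lemma sqnorm_ge0 f : (0 <= sqnorm f)%E.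
Proof. by apply: esum_ge0 => x _; rewrite lee_fin sqr_ge0. Qed.

Lemma normc_ge0 (z : R[i]) : 0 <= normc z.
Proof. by case: z => a b; exact: sqrtr_ge0. Qed.

Lemma esum_scale (c : R) (a : X -> R) : 0 < c -> (forall x, 0 <= a x) ->
  (\esum_(x in [set: X]) (c * a x)%:E =
   c%:E * \esum_(x in [set: X]) (a x)%:E)%E.
Proof.
move=> c0 a0; rewrite /esum -ereal_sup_pZl //; congr ereal_sup.
rewrite image_comp; apply: eq_imagel => A _ /=.
by rewrite ge0_mule_fsumr // => x; rewrite lee_fin.
Qed.

Lemma sqnormZ (c : R[i]) f : c != 0 ->
  sqnorm (c *: f) = ((normc c ^+ 2)%:E * sqnorm f)%E.
Proof.
move=> c0; rewrite /sqnorm -esum_scale.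
- by apply: eq_esum => x _; rewrite Normc.normcM exprMn.
- rewrite exprn_gt0 // lt_neqAle normc_ge0 andbT eq_sym.
  by apply: contra c0 => /eqP/Normc.eq0_normc ->.
- by move=> x; rewrite sqr_ge0.
Qed.

Lemma sqnormD (t : R) f g : 0 < t ->
  (sqnorm (f + g)%R <= (1 + t)%:E * sqnorm f + (1 + t^-1)%:E * sqnorm g)%E.
Proof.
move=> t0; have ti0 : 0 < t^-1 by rewrite invr_gt0.
rewrite /sqnorm -!esum_scale; try by move=> x; rewrite sqr_ge0.
2,3: by lra.
rewrite -esumD; try by move=> x _; rewrite lee_fin mulr_ge0 ?sqr_ge0 //; lra.
apply: le_esum => x _; rewrite -EFinD lee_fin /=.
set u := normc (f x); set v := normc (g x).
have h : normc (f x + g x) <= u + v by exact: le_normcD.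
have h2 : (normc (f x + g x)) ^+ 2 <= (u + v) ^+ 2.
  by rewrite lerXn2r ?nnegrE ?normc_ge0 ?addr_ge0 ?normc_ge0.
apply: (le_trans h2); rewrite -subr_ge0.
have -> : (1 + t) * u ^+ 2 + (1 + t^-1) * v ^+ 2 - (u + v) ^+ 2 =
   t^-1 * (t * u - v) ^+ 2 by field; rewrite gt_eqF.
by rewrite mulr_ge0 ?sqr_ge0 // ltW.
Qed.

Lemma sqnorm0 : sqnorm 0 = 0%E.
Proof. by apply: esum1 => x _; rewrite Normc.normc0 expr0n. Qed.

Lemma square_summable_submod : GRing.submod_closed square_summable.
Proof.
split; first by rewrite unfold_in /square_summable sqnorm0 ltry.
move=> c f g; rewrite !unfold_in /square_summable => hf hg.
have hcf : (sqnorm (c *: f)%R < +oo)%E.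
  have [->|c0] := eqVneq c 0; first by rewrite scale0r sqnorm0 ltry.
  by rewrite sqnormZ // lte_mul_pinfty // lee_fin sqr_ge0.
apply: le_lt_trans (sqnormD _ _ ltr01) _.
by apply: lte_add_pinfty; rewrite lte_mul_pinfty // lee_fin; lra.
Qed.

Record l2 := L2 { l2fun :> X -> R[i]; l2funP : square_summable l2fun }.

HB.instance Definition _ := [isSub for l2fun].
HB.instance Definition _ := [Choice of l2 by <:].
HB.instance Definition _ := GRing.SubChoice_isSubLmodule.Build
  R[i] (X -> R[i]) square_summable l2 square_summable_submod.

Definition l2norm (f : l2) : R := Num.sqrt (fine (sqnorm f)).

Lemma l2norm_ge0 (f : l2) : 0 <= l2norm f. Proof. exact: sqrtr_ge0. Qed.

Lemma sqnormE (f : l2) : sqnorm f = (l2norm f ^+ 2)%:E.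
Proof.
rewrite sqr_sqrtr ?fine_ge0 ?sqnorm_ge0 // fineK //.
by rewrite ge0_fin_numE ?sqnorm_ge0 //; exact: l2funP.
Qed.

Lemma l2normZ (c : R[i]) (f : l2) : l2norm (c *: f) = normc c * l2norm f.
Proof.
have [->|c0] := eqVneq c 0.
  rewrite scale0r Normc.normc0 mul0r /l2norm.
  by rewrite (_ : sqnorm _ = 0%E) ?sqrtr0 //; exact: sqnorm0.
apply/eqP; rewrite -(eqrXn2 (n := 2)) ?mulr_ge0 ?l2norm_ge0 ?normc_ge0 //.
apply/eqP/EFin_inj; rewrite exprMn -(sqnormE (c *: f)) EFinM -(sqnormE f).
exact: sqnormZ.
Qed.

Lemma l2norm_eq0 (f : l2) : l2norm f = 0 -> f = 0.
Proof.
move=> f0; apply/val_inj/funext => x /=.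
have : ((normc (f x) ^+ 2)%:E <= sqnorm f)%E.
  apply: esum_ge; exists [set x]; first by split; [exact: finite_set1|].
  by rewrite fsbig_set1.
rewrite sqnormE f0 expr0n lee_fin => h.
suff /Normc.eq0_normc : normc (f x) = 0 by [].
by apply/eqP; rewrite -sqrf_eq0 eq_le sqr_ge0 andbT.
Qed.

Lemma l2normD (f g : l2) : l2norm (f + g) <= l2norm f + l2norm g.
Proof.
have [f0|f0] := eqVneq (l2norm f) 0.
  by rewrite f0 (l2norm_eq0 f0) !add0r.
have [g0|g0] := eqVneq (l2norm g) 0.
  by rewrite g0 (l2norm_eq0 g0) !addr0.
have {}f0 : 0 < l2norm f by rewrite lt_neqAle eq_sym f0 l2norm_ge0.
have {}g0 : 0 < l2norm g by rewrite lt_neqAle eq_sym g0 l2norm_ge0.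
rewrite -(ler_pXn2r (n := 2)) ?nnegrE ?addr_ge0 ?l2norm_ge0 //.
rewrite -lee_fin -sqnormE.
apply: le_trans (sqnormD _ _ (t := l2norm g / l2norm f) _) _.
  by rewrite divr_gt0.
rewrite !sqnormE -!EFinM -EFinD lee_fin le_eqVlt; apply/orP; left; apply/eqP.
by field; rewrite !gt_eqF.
Qed.

Lemma l2C_normD (f g : l2) :
  (l2norm (f + g))%:C%C <= (l2norm f)%:C%C + (l2norm g)%:C%C.
Proof. by rewrite -rmorphD /= lecR l2normD. Qed.

Lemma l2C_normZ (c : R[i]) (f : l2) :
  (l2norm (c *: f))%:C%C = `|c| * (l2norm f)%:C%C.
Proof. by rewrite l2normZ rmorphM. Qed.

Lemma l2C_norm_eq0 (f : l2) : (l2norm f)%:C%C = 0 :> R[i] -> f = 0.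
Proof. by case=> /l2norm_eq0. Qed.

(* The norm of a normed module over R[i] takes its values in R[i]. *)
HB.instance Definition _ := Lmodule_isNormed.Build R[i] l2
  l2C_normD l2C_normZ l2C_norm_eq0.

End L2.

Section Quasiregular.
Variables (R : realType) (G : groupType) (H : set G).
Local Notation X := (coset_space H).

Lemma sqnorm_translate (g : G) (f : X -> R[i]) :
  sqnorm (f \o translate g) = sqnorm f.
Proof.
rewrite /sqnorm [RHS](reindex_esum [set: X] [set: X] (translate g)) //.
split=> //.
- move=> C D _ _ e; rewrite -[C](translate1 (H := H)) -(mulVg g) translateM e.
  by rewrite -translateM mulVg translate1.
- by move=> C _; exists (translate g^-1%g C); rewrite // -translateM mulgV translate1.
Qed.

Lemma quasiregular_subproof (g : G) (f : l2 R X) :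
  square_summable (f \o translate g^-1%g).
Proof. by rewrite /square_summable sqnorm_translate; exact: l2funP. Qed.

Definition quasiregular (g : G) (f : l2 R X) : l2 R X :=
  L2 (quasiregular_subproof g f).

Lemma quasiregular1 f : quasiregular 1%g f = f.
Proof. by apply/val_inj/funext => C /=; rewrite invg1 translate1. Qed.

Lemma quasiregularM g g' f :
  quasiregular (g * g')%g f = quasiregular g (quasiregular g' f).
Proof. by apply/val_inj/funext => C /=; rewrite invgM translateM. Qed.

Lemma quasiregular_is_linear g : linear (quasiregular g).
Proof. by move=> a f f'; apply/val_inj. Qed.

Lemma norm_quasiregular g f : `|quasiregular g f| = `|f|.
Proof. by congr (Num.sqrt (fine _))%:C%C; exact: sqnorm_translate. Qed.

End Quasiregular.
Arguments quasiregular R {G} H g f.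

Definition irreducible (K : numFieldType) (V : normedModType K) (G : Type)
    (rho : G -> V -> V) : Prop :=
  forall W : set V, submod_closed (mem W) -> closed W ->
    (forall g v, W v -> W (rho g v)) ->
    W = [set 0] \/ W = [set: V].

(* Main.v *)
Require Import Defs.
From HB Require Import structures.
From mathcomp Require Import all_boot all_order all_algebra.
From mathcomp Require Import all_classical all_reals all_analysis.
From mathcomp Require Import complex zify ring lra.

(* The 2-colouring of the Thompson graph of a tree is the parity of the number
   of digits 1 in the binary expansion of the left end of a leaf. Hence [vecT] is
   the set of elements [f] such that [f x] and [x] have digit sums whose
   difference is constant modulo 2 when [x] runs over the dyadic points of the
   circle. For any [g] in [T], this difference is constant on the leaves of a
   tree representing [g].

   Some [h] in [vecT] satisfies [h x > x] on ]0, 1[. If [g^-1 h^n g] is in [vecT]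
   for some [n > 0], then the parity change of [g^-1] is invariant under [h^n]
   and thus constant, as every leaf contains dyadic points pushed into the last
   leaf; so [g] is in [vecT]. Thus [h] fixes the coset of 1 and has an infinite
   orbit on every other coset. If [w] lies in a closed invariant subspace and
   takes the value 1 at the coset of 1, the means of [w, h w, ..., h^(N-1) w]
   converge to the point mass at that coset. The subspace then contains all
   point masses, and is everything. *)

Set Implicit Arguments.
Unset Strict Implicit.
Unset Printing Implicit Defensive.

Import Order.TTheory GRing.Theory Num.Theory.
Import numFieldNormedType.Exports.

Local Open Scope classical_set_scope.
Local Open Scope ring_scope.

(** * Colourings of Thompson graphs *)

(** Each right edge on the path from the root flips the parity, as it adds a digit 1 to the left end
    of the interval. *)
Fixpoint leaf_parities (t : btree) : seq bool :=
  if t is Node l r then leaf_parities l ++ map negb (leaf_parities r)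
  else [:: false].

Definition leaf_parity (t : btree) (i : nat) : bool :=
  nth false (leaf_parities t) i.

Lemma size_leaf_parities t : size (leaf_parities t) = nleaves t.
Proof. by elim: t => //= l IHl r IHr; rewrite size_cat size_map IHl IHr. Qed.

(** The conjunct accounts for the default value [false] beyond the last leaf. *)
Lemma leaf_parityN l r i : leaf_parity (Node l r) i =
  if (i < nleaves l)%N then leaf_parity l i
  else (i - nleaves l < nleaves r)%N && ~~ leaf_parity r (i - nleaves l).
Proof.
rewrite /leaf_parity /= nth_cat size_leaf_parities; case: ifP => // _.
case: ltnP => h; first by rewrite (nth_map false) ?size_leaf_parities.
by rewrite nth_default // size_map size_leaf_parities.
Qed.

Lemma leaf_parity0 t : leaf_parity t 0 = false.
Proof. by elim: t => // l IHl r _; rewrite leaf_parityN nleaves_gt0. Qed.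

Lemma leaf_parity_rightN l r i : (i < nleaves r)%N ->
  leaf_parity (Node l r) (nleaves l + i) = ~~ leaf_parity r i.
Proof. by move=> h; rewrite leaf_parityN ltnNge leq_addr addKn h. Qed.

Lemma leaf_parity_left l r i : (i < nleaves l)%N ->
  leaf_parity (Node l r) i = leaf_parity l i.
Proof. by move=> h; rewrite leaf_parityN h. Qed.

Lemma tree_edges_lt t k i j : (i, j) \in tree_edges t k ->
  (k <= i < k + nleaves t)%N && (k <= j < k + nleaves t)%N.
Proof.
elim: t k => //= l IHl r IHr k; have := nleaves_gt0 l; have := nleaves_gt0 r.
move=> l0 r0; rewrite inE mem_cat => /orP[/eqP[-> ->]|/orP[/IHl|/IHr]]; lia.
Qed.

(** The first vertex of a right subtree is joined to the first vertex of the whole tree, so the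
    graph is connected and the colour at [k] determines all others. *)
Lemma coloring_leaf_parity t k (c : nat -> bool) :
  (forall i j, (i, j) \in tree_edges t k -> c i != c j) ->
  forall i, (i < nleaves t)%N -> c (k + i)%N = c k (+) leaf_parity t i.
Proof.
elim: t k => [|l IHl r IHr] k /= H i.
  by rewrite ltnS leqn0 => /eqP ->; rewrite addn0 addbF.
move=> ilt; case: (ltnP i (nleaves l)) => h.
  rewrite leaf_parity_left //; apply: IHl => // a b ab.
  by apply: H; rewrite inE mem_cat ab orbT.
have hr : (i - nleaves l < nleaves r)%N by rewrite ltn_subLR.
rewrite -(subnKC h) leaf_parity_rightN // addnA.
rewrite (IHr (k + nleaves l)%N) // => [|a b ab]; last first.
  by apply: H; rewrite inE mem_cat ab !orbT.
have : c k != c (k + nleaves l)%N by apply: H; rewrite inE eqxx.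
by case: (c k); case: (c (_ + _)%N) => //=; case: leaf_parity.
Qed.

Lemma leaf_parity_edge t k i j : (i, j) \in tree_edges t k ->
  leaf_parity t (i - k) != leaf_parity t (j - k).
Proof.
elim: t k => //= l IHl r IHr k.
rewrite inE mem_cat => /orP[/eqP[-> ->]|/orP[|]].
- rewrite subnn addKn leaf_parity0 -[nleaves l]addn0.
  by rewrite leaf_parity_rightN ?nleaves_gt0 // leaf_parity0.
- move=> h; have := tree_edges_lt h => hl; rewrite !leaf_parity_left; try lia.
  exact: IHl.
- move=> h; have := tree_edges_lt h => hr.
  have E x : (k + nleaves l <= x)%N ->
      (x - k = nleaves l + (x - (k + nleaves l)))%N by lia.
  rewrite (E i) ?(E j); try lia.
  rewrite !leaf_parity_rightN; try lia.
  by have := IHr _ h; apply: contra => /eqP /(congr1 negb); rewrite !negbK => ->.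
Qed.

Definition ident_inv (m n j : nat) : nat := ((j + (m - n.-1)) %% m)%N.

Lemma ident_ltn m n i : (0 < m)%N -> (ident m n i < m)%N.
Proof. by move=> m0; rewrite ltn_mod. Qed.

Lemma ident_invK m n j : (1 <= n <= m)%N -> (j < m)%N ->
  ident m n (ident_inv m n j) = j.
Proof.
move=> hn jm; rewrite /ident /ident_inv modnDml -addnA subnK; last by lia.
by rewrite modnDr modn_small.
Qed.

Lemma identK m n i : (1 <= n <= m)%N -> (i < m)%N ->
  ident_inv m n (ident m n i) = i.
Proof.
move=> hn jm; rewrite /ident /ident_inv modnDml -addnA subnKC; last by lia.
by rewrite modnDr modn_small.
Qed.

(* The leaf parities of a tree are, up to a global flip, its only proper
   2-colouring, so the two trees must induce the same colouring. *)
Lemma bipartite_thompson_graphP U V n : triple_ok U V n ->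
  bipartite (thompson_graph U V n) <->
  exists e, forall i, (i < nleaves U)%N ->
    leaf_parity V (ident (nleaves U) n i) = leaf_parity U i (+) e.
Proof.
move=> [eUV hn]; have m0 := nleaves_gt0 U.
split=> [[c cP]|[e eP]]; last first.
  exists (fun x : 'I_(nleaves U) => leaf_parity U x) => x y.
  move=> /orP[/orP[]|/orP[]] /leaf_parity_edge;
    rewrite !subn0 ?eP // 1?eq_sym //;
    by case: (e); case: (leaf_parity U x); case: (leaf_parity U y).
pose C i := if insub i is Some x then c x else false.
have CE (x : 'I_(nleaves U)) : C x = c x by rewrite /C valK.
have adjC (x y : nat) : (x < nleaves U)%N -> (y < nleaves U)%N ->
    tree_adj U x y || tree_adj V (ident (nleaves U) n x) (ident (nleaves U) n y)
    -> C x != C y.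
  move=> xm ym xy; rewrite -[x]/(val (Ordinal xm)) -[y]/(val (Ordinal ym)).
  by rewrite !CE; exact: cP.
(* [C'] is the same colouring in the numbering of the leaves of [V]. *)
pose C' := C \o ident_inv (nleaves U) n.
exists (C 0%N (+) C' 0%N) => i im.
have CU : C i = C 0%N (+) leaf_parity U i.
  rewrite -(add0n i); apply: coloring_leaf_parity => // a b ab.
  have := tree_edges_lt ab; rewrite !add0n => abm.
  by apply: adjC; rewrite /tree_adj ?ab //; lia.
have : C' (ident (nleaves U) n i) =
    C' 0%N (+) leaf_parity V (ident (nleaves U) n i).
  rewrite -{1}(add0n (ident (nleaves U) n i)); apply: coloring_leaf_parity.
    move=> a b ab; have := tree_edges_lt ab; rewrite !add0n -eUV => abm.
    apply: adjC; rewrite ?ltn_mod //.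
    by rewrite !ident_invK /tree_adj ?ab ?orbT //; lia.
  by rewrite -eUV ident_ltn.
rewrite {1}/C' /= identK // CU.
by case: (C 0%N); case: (C' 0%N); case: leaf_parity; case: leaf_parity.
Qed.

(** * Digit parity and Jones' subgroup *)

Section DigitParity.
Variable R : realType.
Implicit Types (x y : R) (b e : bool) (t U V : btree).

Fixpoint digit_parity (n : nat) x : bool :=
  if n is n'.+1 then
    if x < 1 / 2 then digit_parity n' (2 * x) else ~~ digit_parity n' (2 * x - 1)
  else false.

(* For [x] in [0, 1) this holds for some [b] exactly when [x] is dyadic, and
   then [b] is the parity of its number of binary digits 1. *)
Definition has_parity x b : Prop :=
  exists N, forall n, (N <= n)%N -> digit_parity n x = b.

Lemma has_parity_inj x b b' : has_parity x b -> has_parity x b' -> b = b'.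
Proof.
move=> [N H] [N' H']; rewrite -(H (maxn N N')) ?leq_maxl //.
by rewrite H' ?leq_maxr.
Qed.

Lemma has_parity0 : has_parity 0 false.
Proof.
exists 0%N => + _; elim=> //= n IHn; rewrite mulr0 IHn.
by case: ltP => //; lra.
Qed.

(** An eventual value is unaffected by shifting the index by one; this serves both halves of
    [[0, 1)]. *)
Lemma has_parity_shift x y b e :
  (forall n, digit_parity n.+1 y = digit_parity n x (+) e) ->
  has_parity y (b (+) e) <-> has_parity x b.
Proof.
move=> E; split=> -[N H].
  exists N => n Nn; apply: (@addIb e).
  by rewrite -E H // leqW.
by exists N.+1 => -[//|n] Nn; rewrite E H.
Qed.

Lemma has_parity_half x b : x < 1 -> has_parity (x / 2) b <-> has_parity x b.
Proof.
move=> x1; rewrite -{1}(addbF b); apply: has_parity_shift => n /=.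
by rewrite ifT ?addbF; [congr digit_parity; lra|lra].
Qed.

Lemma has_parity_half1 x b : 0 <= x ->
  has_parity ((x + 1) / 2) (~~ b) <-> has_parity x b.
Proof.
move=> x1; rewrite -{1}(addbT b); apply: has_parity_shift => n /=.
rewrite ifF ?addbT; first by congr (~~ digit_parity _ _); lra.
by apply/negbTE; rewrite -leNgt; lra.
Qed.

(** Bisection commutes with affine maps, so the leaves below a child are a scaled copy of those of
    the child taken as a tree of its own. *)
Lemma leaf_intervals_affine t (p : R * R) c d :
  leaf_intervals t (c * p.1 + d, c * p.2 + d) =
  [seq (c * q.1 + d, c * q.2 + d) | q <- leaf_intervals t p].
Proof.
elim: t p => [|l IHl r IHr] p //=; rewrite map_cat -IHl -IHr /=.
by congr (leaf_intervals l _ ++ leaf_intervals r _); congr pair; lra.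
Qed.

Lemma leaf_interval_bounds t i : (i < nleaves t)%N ->
  [/\ 0 <= (leaf_interval R t i).1,
      (leaf_interval R t i).1 < (leaf_interval R t i).2
    & (leaf_interval R t i).2 <= 1].
Proof.
move=> it; apply: (leaf_intervals_sub (t := t) (p := (0, 1))) => //=.
by rewrite mem_nth // size_leaf_intervals.
Qed.

Lemma leaf_interval_left l r i : (i < nleaves l)%N ->
  leaf_interval R (Node l r) i =
  ((leaf_interval R l i).1 / 2, (leaf_interval R l i).2 / 2).
Proof.
move=> il; rewrite /leaf_interval /= nth_cat size_leaf_intervals il.
have -> : (0, (0 + 1) / 2) =
    (1 / 2 * (0 : R, 1 : R).1 + 0, 1 / 2 * (0 : R, 1 : R).2 + 0) :> R * R.
  by congr pair => /=; lra.
rewrite leaf_intervals_affine (nth_map (0, 0)) ?size_leaf_intervals //.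
by congr pair; lra.
Qed.

Lemma leaf_interval_right l r i : (i < nleaves r)%N ->
  leaf_interval R (Node l r) (nleaves l + i) =
  (((leaf_interval R r i).1 + 1) / 2, ((leaf_interval R r i).2 + 1) / 2).
Proof.
move=> ir; rewrite /leaf_interval /= nth_cat size_leaf_intervals.
rewrite ltnNge leq_addr /= addKn.
have -> : ((0 + 1) / 2, 1) =
    (1 / 2 * (0 : R, 1 : R).1 + 1 / 2, 1 / 2 * (0 : R, 1 : R).2 + 1 / 2) :> R * R.
  by congr pair => /=; lra.
rewrite leaf_intervals_affine (nth_map (0, 0)) ?size_leaf_intervals //.
by congr pair; lra.
Qed.

(** Mapping [[0, 1)] onto a leaf interval prepends the digits of the path to that leaf; each edge
    contributes a map [x / 2] or [(x + 1) / 2]. *)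
Lemma has_parity_leaf t i x b : (i < nleaves t)%N -> 0 <= x < 1 ->
  has_parity (affine (0, 1) (leaf_interval R t i) x) (b (+) leaf_parity t i)
  <-> has_parity x b.
Proof.
elim: t i b => [|l IHl r IHr] i b.
  rewrite ltnS leqn0 => /eqP -> x01.
  by rewrite /leaf_interval /= affine_id ?addbF ?ltr01.
move=> it x01; case: (ltnP i (nleaves l)) => h.
  have [a1 a2 a3] := leaf_interval_bounds h.
  have := affine_in (p := (0, 1)) (q := leaf_interval R l i) (x := x) ltr01 a2.
  rewrite leaf_interval_left // leaf_parity_left // -(IHl i b h x01).
  rewrite (_ : affine _ (_ / 2, _) x = affine (0, 1) (leaf_interval R l i) x / 2).
    by rewrite /in_interval /= => /(_ x01) y1; apply: has_parity_half; lra.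
  by rewrite /affine /=; field.
have {}it : (i - nleaves l < nleaves r)%N by rewrite ltn_subLR.
rewrite -(subnKC h); set j := (i - _)%N in it *.
have [a1 a2 a3] := leaf_interval_bounds it.
have := affine_in (p := (0, 1)) (q := leaf_interval R r j) (x := x) ltr01 a2.
rewrite leaf_interval_right // leaf_parity_rightN // -(IHr j b it x01) addbN.
rewrite (_ : affine _ ((_ + 1) / 2, _) x =
  (affine (0, 1) (leaf_interval R r j) x + 1) / 2).
  by rewrite /in_interval /= => /(_ x01) y1; apply: has_parity_half1; lra.
by rewrite /affine /=; field.
Qed.

Lemma has_parity_leaf_left t i : (i < nleaves t)%N ->
  has_parity (leaf_interval R t i).1 (leaf_parity t i).
Proof.
move=> it; have := @has_parity_leaf t i 0 false it.
rewrite lexx ltr01 => /(_ isT)[_ /(_ has_parity0)].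
by rewrite /affine /= subrr !mul0r addr0.
Qed.

(** On a leaf, [f] replaces one binary prefix by another: its affine map factors through [(0, 1)],
    and each factor shifts the parity by that of a leaf. *)
Lemma represents_has_parity U V n (f : circle R -> circle R) i (y : circle R) b :
  represents U V n f -> (i < nleaves U)%N ->
  in_interval (leaf_interval R U i) y -> has_parity y b ->
  has_parity (f y)
    (b (+) (leaf_parity U i (+) leaf_parity V (ident (nleaves U) n i))).
Proof.
move=> [[eUV _] H] iU yi; rewrite (H i iU y yi).
set j := ident _ _ _.
have jV : (j < nleaves V)%N by rewrite -eUV ident_ltn ?nleaves_gt0.
have [a1 a2 a3] := leaf_interval_bounds iU.
have := @has_parity_leaf U i (affine (leaf_interval R U i) (0, 1) y)
  (b (+) leaf_parity U i) iU.
have h01 := affine_in (q := (0, 1)) a2 ltr01 yi.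
rewrite affine_comp ?ltr01 // affine_id // => /(_ h01).
rewrite -addbA addbb addbF => -> h.
rewrite addbA -(affine_comp (q := (0, 1))) ?ltr01 //.
by rewrite has_parity_leaf.
Qed.

Lemma leaf_of_point t (y : circle R) :
  exists2 i, (i < nleaves t)%N & in_interval (leaf_interval R t i) y.
Proof.
have : has (fun p : R * R => in_interval p y) (leaf_intervals t (0, 1)).
  by rewrite has_count count_leaf_intervals ?ltr01 // /in_interval cpointP.
by case/(has_nthP (0, 0)) => i; rewrite size_leaf_intervals => it yi; exists i.
Qed.

(** [t'] is [t] with the caret at [i] collapsed to a single leaf, of interval [q]. *)
Lemma caret_leaves_join t k i : i \in caret_leaves t k -> exists t',
  nleaves t = (nleaves t').+1 /\ forall p : R * R, exists A q B,
  [/\ (k + size A)%N = i, leaf_intervals t' p = A ++ q :: B &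
   leaf_intervals t p =
     A ++ (q.1, (q.1 + q.2) / 2) :: ((q.1 + q.2) / 2, q.2) :: B].
Proof.
elim: t k => //= l IHl r IHr k.
(* A tree with two leaves is a single caret, the exceptional branch of [caret_leaves]. *)
have [isl|] := boolP ((nleaves l + nleaves r)%N == 2).
  case: l isl {IHl IHr} => [|l1 l2]; case: r => [|r1 r2] //=; last first.
  - by have := nleaves_gt0 l1; have := nleaves_gt0 l2;
      have := nleaves_gt0 r1; have := nleaves_gt0 r2; lia.
  - by have := nleaves_gt0 l1; have := nleaves_gt0 l2; lia.
  - by have := nleaves_gt0 r1; have := nleaves_gt0 r2; lia.
  move=> _; rewrite inE => /eqP ->; exists Leaf; split=> // p.
  by exists [::], p, [::]; rewrite addn0.
move=> h2 hi.
have {hi} : i \in caret_leaves l k ++ caret_leaves r (k + nleaves l).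
  by case: l r hi h2 {IHl IHr} => [|? ?] [|? ?].
rewrite mem_cat => /orP[/IHl[t' [nt H]]|/IHr[t' [nt H]]].
  exists (Node t' r); split; first by rewrite /= nt.
  move=> p; have [A [q [B [kA e' e]]]] := H (p.1, (p.1 + p.2) / 2).
  by exists A, q, (B ++ leaf_intervals r ((p.1 + p.2) / 2, p.2));
    rewrite /= e e' -!catA.
exists (Node l t'); split; first by rewrite /= nt addnS.
move=> p; have [A [q [B [kA e' e]]]] := H ((p.1 + p.2) / 2, p.2).
exists (leaf_intervals l (p.1, (p.1 + p.2) / 2) ++ A), q, B.
by rewrite /= e e' -!catA size_cat size_leaf_intervals addnA.
Qed.

Lemma sends_join (f : circle R -> circle R) (p q : R * R) :
  p.1 < p.2 ->
  sends f ((p.1, (p.1 + p.2) / 2), (q.1, (q.1 + q.2) / 2)) ->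
  sends f (((p.1 + p.2) / 2, p.2), ((q.1 + q.2) / 2, q.2)) -> sends f (p, q).
Proof.
move=> hp h1 h2 x /= /andP[x1 x2].
case: (ltP (x : R) ((p.1 + p.2) / 2)) => hx.
  rewrite h1 /in_interval /= ?x1 // /affine /=; field.
  by rewrite subr_eq0 gt_eqF.
rewrite h2 /in_interval /= ?hx // /affine /=; field.
by rewrite subr_eq0 gt_eqF.
Qed.

(* A pair of matched carets can be removed: after rotating both subdivisions so
   that they start with these carets, the two halves are glued. *)
Lemma reduced_represents_ex U V n (f : circle R -> circle R) :
  represents U V n f -> exists U' V' n', represents U' V' n' f /\ reduced U' V' n'.
Proof.
move: {2}(nleaves U) (erefl (nleaves U)) => m.
elim: m U V n => [|m IHm] U V n Um rf; first by have := nleaves_gt0 U; lia.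
have [red|] := pselect (reduced U V n); first by exists U, V, n.
move=> /notP[i [j [iU jV eij _]]].
have [U' [nU /(_ (0, 1))[A [q [B [sA eU' eU]]]]]] := caret_leaves_join iU.
have [V' [nV /(_ (0, 1))[A' [q' [B' [sA' eV' eV]]]]]] := caret_leaves_join jV.
have := rf; rewrite representsE => -[[eUV /andP[n0 nUn]] M].
have sV : size (leaf_intervals V (0 : R, 1)) = nleaves U.
  by rewrite size_leaf_intervals.
have sU : size (leaf_intervals U (0 : R, 1)) = nleaves U.
  by rewrite size_leaf_intervals.
have iltU : (i < nleaves U)%N by rewrite -sU eU size_cat /=; lia.
have jltV : (j < nleaves U)%N by rewrite -sV eV size_cat /=; lia.
(* After rotation by [i] the source starts with its caret, and the target with leaf [i + n.-1]
   modulo the number of leaves, which is [j]. *)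
have := matches_rot i M.
have -> : rot i (rot n.-1 (leaf_intervals V (0, 1))) =
    rot j (leaf_intervals V (0 : R, 1)).
  rewrite rot_add_mod ?sV; try lia; move: eij; rewrite /ident.
  case: ltngtP => h eij.
  - by rewrite -eij modn_small.
  - by rewrite -eij -[X in (X %% _)%N](subnK (ltnW h)) modnDr modn_small //; lia.
  - by rewrite -eij h modnn rot0 -sV rot_size.
rewrite eU eV -sA -sA' !add0n !rot_size_cat /=.
move=> [/= sz H].
have M' : matches f (q :: B ++ A) (q' :: B' ++ A').
  split; first by move: sz => /=; lia.
  move=> pq; rewrite inE => /orP[/eqP ->|pqI].
    apply: sends_join; last 2 first.
    - by apply: H; rewrite inE eqxx.
    - by apply: H; rewrite !inE eqxx orbT.
    by apply: (leaf_intervals01 (t := U')); rewrite eU' mem_cat inE eqxx orbT.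
  by apply: H; rewrite !inE pqI !orbT.
have rU' : q :: B ++ A = rot (size A) (leaf_intervals U' (0, 1)).
  by rewrite eU' rot_size_cat.
have rV' : q' :: B' ++ A' = rot (size A') (leaf_intervals V' (0, 1)).
  by rewrite eV' rot_size_cat.
(* Rotating the source back to its first leaf leaves a rotation [k] of the target, which yields the
   new shift. *)
have := matches_rot (size (rot (size A) (leaf_intervals U' (0 : R, 1))) - size A) M'.
rewrite rU' rV' (rotK (size A) (leaf_intervals U' (0 : R, 1)) : rot _ _ = _).
rewrite rot_rot_add.
set k := rot_add _ _ _ => M''.
have sV'0 : (0 < size (leaf_intervals V' (0%R : R, 1%R)))%N.
  by rewrite size_leaf_intervals nleaves_gt0.
have [n' hn' rn'] := @rot_range _ _ k sV'0; rewrite rn' in M''.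
apply: (IHm U' V' n'); first by rewrite nU in Um; case: Um.
apply/representsE; split=> //; split; first by lia.
by move: hn'; rewrite size_leaf_intervals; lia.
Qed.

(** * Jones' subgroup in terms of digit parity *)

Definition parity_preserving (f : circle R -> circle R) : Prop :=
  exists e, forall (y : circle R) b, has_parity y b -> has_parity (f y) (b (+) e).

(** Bipartiteness says that the parity change is the same on all leaves; on each leaf it can be read
    off at the left end, a dyadic point. *)
Lemma bipartite_parity_preserving U V n (f : circle R -> circle R) :
  represents U V n f ->
  bipartite (thompson_graph U V n) <-> parity_preserving f.
Proof.
move=> rf; have [ok _] := rf; rewrite bipartite_thompson_graphP //.
split=> -[e H]; exists e.
  move=> y b yb; have [i iU yi] := leaf_of_point U y.
  have := represents_has_parity rf iU yi yb.
  by rewrite H // [leaf_parity U i (+) _]addbA addbb.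
move=> i iU; have [h0 h1 h2] := leaf_interval_bounds iU.
have h01 : 0 <= (leaf_interval R U i).1 < 1 by lra.
have yi : in_interval (leaf_interval R U i) (Circle h01).
  by rewrite /in_interval /= lexx.
have yb : has_parity (Circle h01) (leaf_parity U i) by exact: has_parity_leaf_left.
have := represents_has_parity rf iU yi yb; rewrite addbA addbb addFb.
by move/has_parity_inj; apply; exact: H.
Qed.

(** Parity preservation refers to no triple, so it may be tested on any representing triple and
    transferred to a reduced one. *)
Lemma vecTP (f : thompson R) : vecT R f <-> parity_preserving f.
Proof.
split=> [[U [V [n [rf _ bip]]]]|fP].
  by rewrite -(bipartite_parity_preserving rf).
have [U [V [n rf]]] := thompson_in_T f.
have [U' [V' [n' [rf' red]]]] := reduced_represents_ex rf.
by exists U', V', n'; split=> //; rewrite (bipartite_parity_preserving rf').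
Qed.

End DigitParity.

(** * Infinite orbits on the cosets *)

Section Pushing.
Variable R : realType.
Implicit Types (F k : circle R -> circle R) (y : circle R).

Lemma last_leaf t : exists2 i, (i < nleaves t)%N & (leaf_interval R t i).2 = 1.
Proof.
elim: t => [|l _ r [i ir i1]]; first by exists 0%N.
exists (nleaves l + i)%N; first by rewrite ltn_add2l.
by rewrite leaf_interval_right // i1 /=; lra.
Qed.

(** The second condition is a quantitative form of [F y > y] on []0, 1[]. The constant suits the
    element built below, which satisfies [F x - x = 3 / 4 * (1 - x)] on its last leaf. *)
Definition pushing F : Prop :=
  (forall y b, has_parity y b -> has_parity (F y) b) /\
  (forall y, (y : R) + 3 / 4 * ((y : R) * (1 - (y : R))) <= (F y : R)).

Lemma pushing_ge F y : pushing F -> (y : R) <= (F y : R).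
Proof.
move=> [_ /(_ y)]; apply: le_trans; rewrite lerDl.
by have /andP[y0 y1] := cpointP y; rewrite !mulr_ge0 //; lra.
Qed.

Lemma pushing_iter F n : pushing F -> pushing (iter n.+1 F).
Proof.
move=> pF; have [Fp Fl] := pF; elim: n => [|n [IHp IHl]]; first by split.
split=> y; first by move=> b /IHp /Fp.
by apply: le_trans (IHl y) _; exact: pushing_ge.
Qed.

Lemma pushing_escape F y (a : R) : pushing F -> 0 < (y : R) -> a < 1 ->
  exists r, a <= (iter r F y : R).
Proof.
move=> pF y0 a1; have [_ Fl] := pF.
(* As long as the orbit stays between [y] and [a], each step gains at least [c]. *)
pose c : R := 3 / 4 * ((y : R) * (1 - a)).
have c0 : 0 < c by rewrite !mulr_gt0 //; lra.
have [//|H] := pselect (exists r, a <= (iter r F y : R)).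
have lt r : (iter r F y : R) < a by rewrite ltNge; apply/negP => h; apply: H; exists r.
have ge r : (y : R) <= (iter r F y : R).
  by elim: r => // r IH; apply: (le_trans IH); exact: pushing_ge.
have grow r : c * r%:R <= (iter r F y : R).
  elim: r => [|r IH]; first by rewrite mulr0 ltW.
  rewrite iterS; apply: le_trans (Fl _); rewrite -natr1 mulrDr mulr1 lerD //.
  by rewrite /c ler_pM2l ?ler_pM //; have := lt r; have := ge r; lra.
have [r] : exists r : nat, c^-1 < r%:R.
  by exists (Num.bound c^-1); rewrite archi_boundP // invr_ge0 ltW.
rewrite -(ltr_pM2l c0) mulfV ?gt_eqF // => h.
have := grow r; have := lt r; lra.
Qed.

(* The element replacing the binary prefixes 00, 010, 011, 1 by 0, 10, 110, 111
   respectively, which have the same digit sums modulo 2. *)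
Lemma exists_pushing : exists h : thompson R, pushing h.
Proof.
pose U := Node (Node Leaf (Node Leaf Leaf)) Leaf.
pose V := Node Leaf (Node Leaf (Node Leaf Leaf)).
have [//|f rf] := @represents_ex R U V 1.
exists (Thompson (asboolT (ex_intro _ U (ex_intro _ V (ex_intro _ 1%N rf))))).
split=> y /=.
  move=> b yb; have [i iU yi] := leaf_of_point U y.
  have := represents_has_parity rf iU yi yb.
  suff -> : leaf_parity V (ident (nleaves U) 1 i) = leaf_parity U i.
    by rewrite addbb addbF.
  by case: i iU {yi} => [|[|[|[|]]]].
have [_ H] := rf; have [i iU yi] := leaf_of_point U y.
rewrite (H i iU y yi); have /andP[y0 y1] := cpointP y.
move: (y : R) y0 y1 yi => x x0 x1.
have sq : 0 <= x * x by rewrite mulr_ge0.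
have sq1 : 0 <= (1 - x) * (1 - x) by rewrite mulr_ge0 //; lra.
case: i iU => [|[|[|[|]]]] // _;
  rewrite /in_interval /leaf_interval /affine /= => /andP[? ?].
- rewrite [leRHS](_ : _ = 2 * x); [nra|by field].
- rewrite [leRHS](_ : _ = 2 * x); [nra|by field].
- rewrite [leRHS](_ : _ = x + 3 / 8); [nra|by field].
- rewrite [leRHS](_ : _ = 3 / 4 + x / 4); [nra|by field].
Qed.

(* [k] changes the parity of the points of a leaf by a constant; pushing moves
   every leaf into the last one, so that this constant is the same for all. *)
Lemma conj_pushing_parity_preserving k F e : in_T k -> pushing F ->
  (forall y b, has_parity (k y) b -> has_parity (k (F y)) (b (+) e)) ->
  parity_preserving k.
Proof.
move=> [U [V [n rk]]] pF He; have [Fp Fl] := pF.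
pose D i := leaf_parity U i (+) leaf_parity V (ident (nleaves U) n i).
have Dk i y b := @represents_has_parity R U V n k i y b rk.
(* Compare the changes [D] at [y] and at [F y], which has the same parity as [y]. *)
have step i j y b : (i < nleaves U)%N -> (j < nleaves U)%N ->
    in_interval (leaf_interval R U i) y ->
    in_interval (leaf_interval R U j) (F y) ->
    has_parity y b -> D j = D i (+) e.
  move=> iU jU yi yj yb; have h1 := He _ _ (Dk _ _ _ iU yi yb).
  have := has_parity_inj h1 (Dk _ _ _ jU yj (Fp _ _ yb)).
  rewrite -/(D i) -/(D j).
  by case: b {yb h1}; case: (D i); case: (D j); case: (e).
have [l lU l1] := last_leaf U; have [l_ge0 l_lt l_le1] := leaf_interval_bounds R lU.
have inl y : (leaf_interval R U l).1 <= (y : R) ->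
    in_interval (leaf_interval R U l) y.
  by move=> h; rewrite /in_interval h l1; case/andP: (cpointP y).
have l01 : 0 <= (leaf_interval R U l).1 < 1 by lra.
(* The left end of the last leaf is pushed within that leaf. *)
have e0 : e = false.
  have := step l l (Circle l01) (leaf_parity U l) lU lU.
  rewrite !inl //=; last exact: (pushing_ge (Circle l01) pF).
  by move=> /(_ isT isT (has_parity_leaf_left R lU)); case: (D l); case: (e).
have orbit r i j y b : (i < nleaves U)%N -> (j < nleaves U)%N ->
    in_interval (leaf_interval R U i) y ->
    in_interval (leaf_interval R U j) (iter r F y) -> has_parity y b -> D j = D i.
  elim: r j => [|r IH] j iU jU yi /= yj yb.
    have := has_parity_inj (Dk _ _ _ iU yi yb) (Dk _ _ _ jU yj yb).
    by rewrite -/(D i) -/(D j); case: b {yb}; case: (D i); case: (D j).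
  have [j' j'U yj'] := leaf_of_point U (iter r F y).
  have yb' : has_parity (iter r F y) b by elim: r {IH yj yj'} => //= r /Fp.
  by rewrite (step j' j (iter r F y) b) // (IH j') // e0 addbF.
have DE i : (i < nleaves U)%N -> D i = D l.
  move=> iU; have [i0 ilt i1] := leaf_interval_bounds R iU.
  (* The midpoint of the leaf is dyadic and, unlike the left end of the first leaf, positive, so its
     orbit escapes to the last leaf. *)
  have h2 : 0 <= (1 / 2 : R) < 1 by lra.
  have yi := affine_in (p := (0, 1)) (q := leaf_interval R U i) ltr01 ilt h2.
  set x := affine _ _ _ in yi; have x01 : 0 <= x < 1.
    by move: yi; rewrite /in_interval; lra.
  have x0 : 0 < x by rewrite /x /affine /= !subr0 divr1; lra.
  have xb : has_parity x (true (+) leaf_parity U i).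
    have := has_parity0 R; rewrite -has_parity_half1 // add0r => hb.
    by apply/has_parity_leaf.
  have [r hr] := @pushing_escape F (Circle x01) (leaf_interval R U l).1 pF x0
    (proj2 (andP l01)).
  by rewrite (orbit r i l (Circle x01) _ iU lU yi _ xb) //; exact: inl.
exists (D l) => y b yb; have [i iU yi] := leaf_of_point U y.
by rewrite -(DE i iU); exact: Dk.
Qed.

End Pushing.

(** * Jones' subgroup is a subgroup; conjugates of powers of a pushing element *)

Section Cosets.
Variable R : realType.
Local Open Scope group_scope.
Local Notation H := (vecT R).

Lemma thompson_expgE (h : thompson R) n y : (h ^+ n) y = iter n h y.
Proof. by elim: n y => //= n IH y; rewrite expgS /= -IH. Qed.

Lemma vecT1 : H 1.
Proof. by apply/vecTP; exists false => y b; rewrite addbF. Qed.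

Lemma vecTM (f g : thompson R) : H f -> H g -> H (f * g).
Proof.
move=> /vecTP[e He] /vecTP[e' He']; apply/vecTP; exists (e' (+) e) => y b yb.
by rewrite addbA; apply: He; exact: He'.
Qed.

(** Dyadic points go to dyadic points, which lets parities be pulled back through an inverse. *)
Lemma thompson_has_parity (f : thompson R) (y : circle R) b :
  has_parity y b -> exists b', has_parity (f y) b'.
Proof.
move=> yb; have [U [V [n rf]]] := thompson_in_T f.
have [i iU yi] := leaf_of_point U y.
by eexists; exact: represents_has_parity rf iU yi yb.
Qed.

Lemma vecTV (f : thompson R) : H f -> H f^-1.
Proof.
move=> /vecTP[e He]; apply/vecTP; exists e => y b yb.
have [b' yb'] := thompson_has_parity f^-1 yb.
have := He _ _ yb'; rewrite -[f _]/((f * f^-1) y) mulgV => /(has_parity_inj yb) ->.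
by rewrite -addbA addbb addbF.
Qed.

(** The conjugate sends [g^-1 y] to [g^-1 (h^(n+1) y)], so the previous criterion applies to [g^-1]
    and the pushing map [h ^+ n.+1]. *)
Lemma conj_pushing_vecT (h g : thompson R) n : pushing h ->
  H (g^-1 * h ^+ n.+1 * g) -> H g.
Proof.
move=> /(pushing_iter n) hP /vecTP[e He]; rewrite -[g]invgK; apply/vecTV/vecTP.
apply: (conj_pushing_parity_preserving (thompson_in_T _) hP (e := e)) => y b yb.
have := He _ _ yb; rewrite -thompson_expgE.
by rewrite [(_ * g) _]/(((g^-1 * h ^+ n.+1) \o (g * g^-1)) y) mulgV.
Qed.

End Cosets.

(** * Irreducibility *)

Section L2Delta.
Variables (R : realType) (X : choiceType).
Local Notation normc := Normc.normc.
Local Notation l2 := (l2 R X).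
Implicit Types (f : X -> R[i]) (v : l2) (x y : X).

Lemma l2funB (v w : l2) x : (v - w) x = v x - w x. Proof. by []. Qed.
Lemma l2funZ (c : R[i]) v x : (c *: v) x = c * v x. Proof. by []. Qed.
Lemma l2fun_sum (I : Type) (r : seq I) (F : I -> l2) x :
  (\sum_(i <- r) F i) x = \sum_(i <- r) F i x.
Proof. by elim/big_rec2: _ => // i y v _ <-. Qed.

Lemma normc1 : normc (1 : R[i]) = 1.
Proof.
rewrite [LHS]/(Num.sqrt (1 ^+ 2 + 0 ^+ 2)) expr0n expr1n ?mulr0n ?addr0.
exact: sqrtr1.
Qed.

Lemma sqnorm_mem (s : seq X) : uniq s ->
  sqnorm (fun x => (x \in s)%:R : R[i]) = (size s)%:R%:E.
Proof.
move=> us; rewrite /sqnorm.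
transitivity (\esum_(x in [set` s]) (1 : R)%:E)%E.
  rewrite [RHS]esum_mkcond; apply: eq_esum => x _ /=.
  rewrite mem_setE; case: (x \in s); rewrite ?normc1 ?expr1n //.
  by rewrite Normc.normc0 expr0n.
rewrite esum_fset //.
by rewrite -fsbig_seq // sumEFin big_const_seq count_predT iter_addr_0.
Qed.

Lemma delta_subproof x : square_summable (fun y => (y == x)%:R : R[i]).
Proof.
have := @sqnorm_mem [:: x] isT; rewrite /square_summable.
by under eq_fun do rewrite inE; move=> ->; rewrite ltry.
Qed.

Definition delta x : l2 := L2 (delta_subproof x).

Lemma deltaE x y : delta x y = (y == x)%:R. Proof. by []. Qed.

Lemma l2fun_sum_delta (c : X -> R[i]) (s : seq X) y : uniq s ->
  (\sum_(x <- s) c x *: delta x) y = if y \in s then c y else 0.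
Proof.
rewrite l2fun_sum; elim: s => [|x s IH]; first by rewrite big_nil.
rewrite cons_uniq => /andP[xs us]; rewrite big_cons IH // inE l2funZ deltaE.
rewrite mulr_natr mulrb.
by case: eqVneq => [->|_]; rewrite ?(negbTE xs) ?addr0 ?add0r.
Qed.

(** Distinct point masses are orthonormal. Growth like a square root, rather than linear, is what
    makes means along infinite orbits small. *)
Lemma l2norm_sum_delta (s : seq X) : uniq s ->
  l2norm (\sum_(x <- s) delta x) = Num.sqrt (size s)%:R.
Proof.
move=> us; rewrite /l2norm (_ : l2fun _ = fun x => (x \in s)%:R) ?sqnorm_mem //.
apply/funext => y; under eq_bigr do rewrite -[delta _]scale1r.
by rewrite l2fun_sum_delta //; case: ifP.
Qed.

Lemma l2norm_sum (I : Type) (r : seq I) (F : I -> l2) :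
  l2norm (\sum_(i <- r) F i) <= \sum_(i <- r) l2norm (F i).
Proof.
elim/big_rec2: _ => [|i a v _ h]; last first.
  by apply: le_trans (l2normD _ _) _; rewrite lerD2l.
by rewrite -(scale0r 0) l2normZ Normc.normc0 mul0r.
Qed.

(** The squared norm is a supremum of finite sums; outside a nearly optimal finite set less than
    [e ^+ 2] remains. *)
Lemma l2_approx v (e : R) : 0 < e ->
  exists s : seq X, l2norm (v - \sum_(x <- s) v x *: delta x) < e.
Proof.
move=> e0; pose a x := ((normc (v x)) ^+ 2)%:E.
have a0 x : (0 <= a x)%E by rewrite lee_fin sqr_ge0.
have vfin : sqnorm v \is a fin_num by rewrite sqnormE.
have [_ [F [Ffin _] <-] hF] : exists2 z,
    [set (\sum_(x \in F) a x)%E | F in fsets [set: X]] z &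
    (sqnorm v - (e ^+ 2)%:E < z)%E.
  apply: ub_ereal_sup_adherent => //; exact: exprn_gt0.
have [s us sF] : exists2 s : seq X, uniq s & F = [set` s].
  have /finite_seqP[s ->] := Ffin; exists (undup s); first exact: undup_uniq.
  by apply/seteqP; split=> x /=; rewrite mem_undup.
exists s; rewrite -(ltr_pXn2r (n := 2)) ?nnegrE ?l2norm_ge0 ?(ltW e0) //.
rewrite -lte_fin -sqnormE.
have E : (sqnorm v = \sum_(x \in F) a x +
    sqnorm (v - \sum_(x <- s) v x *: delta x : l2)%R)%E.
  rewrite /sqnorm (esumID F); last by move=> x _; exact: a0.
  congr (_ + _)%E.
    by rewrite setTI esum_fset // => x _; exact: a0.
  rewrite setTI esum_mkcond; apply: eq_esum => y _.
  rewrite l2funB l2fun_sum_delta // in_setC sF mem_setE.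
  rewrite if_neg; case: ifP => _; last by rewrite subr0.
  by rewrite subrr Normc.normc0 expr0n.
move: hF E; rewrite sF -fsbig_seq // sumEFin.
by rewrite !sqnormE -EFinB -EFinD lte_fin => h [E]; rewrite lte_fin; lra.
Qed.


End L2Delta.

Lemma closed_l2 (R : realType) (X : choiceType) (W : set (l2 R X)) v :
  closed W -> (forall e : R, 0 < e -> exists2 w, W w & l2norm (v - w) < e) ->
  W v.
Proof.
move=> cW H; apply: cW => B /nbhs_ballP[e /= e0 vB].
(* A positive element of [R[i]] is real. *)
have [r r0 er] : exists2 r : R, 0 < r & e = r%:C%C.
  case: e e0 {vB} => a b; rewrite ltcE /= => /andP[/eqP -> a0]; by exists a.
have [w Ww vw] := H r r0; exists w; split=> //; apply: vB.
by rewrite -ball_normE /ball_ /= er ltcR.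
Qed.

(** * A criterion for irreducibility by averaging *)

Section Irreducibility.
Variables (R : realType) (G : groupType) (H : set G).
Local Notation X := (coset_space H).
Local Notation rho := (quasiregular R H).
Implicit Types (C : X) (g h : G).

Lemma coset_subproof g : (fun h => (g * h)%g) @` H \in coset_set H.
Proof. by rewrite inE; exists g. Qed.

Definition coset g : X := exist (fun D => D \in coset_set H) _ (coset_subproof g).

Lemma translate_coset g g' : translate g (coset g') = coset (g * g')%g.
Proof.
apply/val_inj/seteqP; split=> [_ [_ [h Hh <-] <-]|_ [h Hh <-]] /=.
  by exists h => //; rewrite mulgA.
by exists (g' * h)%g; [exists h|rewrite mulgA].
Qed.

Lemma coset_surj C : exists g, C = coset g.
Proof.
case: C => D D_coset; have := D_coset; rewrite inE => -[g _ gD]; exists g.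
exact/val_inj.
Qed.

Lemma l2norm_quasiregular g v : l2norm (rho g v) = l2norm v.
Proof. by congr (Num.sqrt (fine _)); exact: sqnorm_translate. Qed.

Lemma quasiregular_delta g C : rho g (delta R C) = delta R (translate g C).
Proof.
apply/val_inj/funext => D; rewrite /= -[D in RHS](translate1 (H := H)) -(mulgV g).
rewrite translateM; congr (_%:R); congr nat_of_bool.
apply/eqP/eqP => [->//|e]; rewrite -[LHS](translate1 (H := H)) -(mulVg g) translateM e.
by rewrite -translateM mulVg translate1.
Qed.

HB.instance Definition _ g := GRing.isLinear.Build R[i] (l2 R X) (l2 R X) *:%R
  (rho g) (quasiregular_is_linear g).

(* The mean of the translates of a point mass along an infinite orbit tends to
   0, and finite sums of point masses are dense. *)
Lemma mean_quasiregular_small h C0 (u : l2 R X) (e : R) : 0 < e ->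
  (forall C, C <> C0 -> injective (fun n : nat => translate (h ^+ n)%g C)) ->
  u C0 = 0 ->
  exists2 N, (0 < N)%N &
    l2norm ((N%:R)^-1 *: \sum_(i < N) rho (h ^+ i)%g u) < e.
Proof.
move=> e0 hinj uC0; have e20 : 0 < e / 2 by rewrite divr_gt0.
have [s hs] := l2_approx u e20.
set w := \sum_(x <- s) _ in hs.
pose K := \sum_(x <- s) Normc.normc (u x).
have K0 : 0 <= K by apply: sumr_ge0 => x _; exact: normc_ge0.
(* The remainder [u - w] costs its norm [N] times, while each point mass away from [C0] contributes
   only the square root of [N]. *)
have bound N : l2norm (\sum_(i < N) rho (h ^+ i)%g u) <=
    N%:R * l2norm (u - w) + K * Num.sqrt N%:R.
  have -> : \sum_(i < N) rho (h ^+ i)%g u =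
      \sum_(i < N) rho (h ^+ i)%g (u - w) +
      \sum_(x <- s) u x *: \sum_(i < N) delta R (translate (h ^+ i)%g x).
    rewrite -[in LHS](subrK w u).
    under eq_bigr do rewrite linearD /=; rewrite big_split; congr (_ + _).
    under [RHS]eq_bigr do rewrite scaler_sumr.
    rewrite exchange_big /=; apply: eq_bigr => i _; rewrite linear_sum.
    by apply: eq_bigr => x _; rewrite linearZ /= quasiregular_delta.
  apply: le_trans (l2normD _ _) _; apply: lerD.
    apply: le_trans (l2norm_sum _ _) _.
    under eq_bigr do rewrite l2norm_quasiregular.
    by rewrite sumr_const card_ord mulr_natl.
  apply: le_trans (l2norm_sum _ _) _; rewrite /K mulr_suml.
  apply: ler_sum => x _; rewrite l2normZ.
  have [->|/eqP xC0] := eqVneq x C0; first by rewrite uC0 Normc.normc0 !mul0r.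
  rewrite ler_wpM2l ?normc_ge0 //.
  rewrite -(big_map (fun i : 'I_N => translate (h ^+ i)%g x) predT (@delta R X)).
  rewrite l2norm_sum_delta; last first.
    rewrite map_inj_uniq ?index_enum_uniq // => i j /(hinj _ xC0).
    exact: ord_inj.
  by rewrite size_map /index_enum -enumT size_enum_ord.
(* This makes the square root of [M] exceed [2 * K / e], so that the second term of [bound M] is
   below [e / 2 * M]. *)
pose M := Num.bound ((2 * K / e) ^+ 2).
have hM : (2 * K / e) ^+ 2 < M%:R by rewrite archi_boundP // sqr_ge0.
have M0 : 0 < M%:R :> R by apply: le_lt_trans hM; exact: sqr_ge0.
exists M; first by rewrite -(ltr0n R).
rewrite l2normZ.
have -> : Normc.normc ((M%:R)^-1 : R[i]) = M%:R^-1.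
  apply: (@complexI R); rewrite -[LHS]/(`|(M%:R)^-1 : R[i]|) normfV normr_nat.
  by rewrite fmorphV rmorph_nat.
rewrite mulrC ltr_pdivrMr //; apply: le_lt_trans (bound M) _.
have sM0 : 0 < Num.sqrt (M%:R : R) by rewrite sqrtr_gt0.
have hK : K < e / 2 * Num.sqrt M%:R.
  have : 2 * K / e < Num.sqrt M%:R.
    rewrite -(ltr_pXn2r (n := 2)) ?nnegrE ?(ltW sM0) ?sqr_sqrtr ?(ltW M0) //.
    by rewrite divr_ge0 ?mulr_ge0 // ltW.
  by rewrite ltr_pdivrMr // => ?; lra.
have : K * Num.sqrt M%:R < e / 2 * M%:R.
  by rewrite -{2}(sqr_sqrtr (ltW M0)) expr2 mulrA ltr_pM2r.
have : M%:R * l2norm (u - w) < M%:R * (e / 2) by rewrite ltr_pM2l.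
by lra.
Qed.

Lemma quasiregular_irreducible h :
  translate h (coset 1%g) = coset 1%g ->
  (forall C, C <> coset 1%g ->
    injective (fun n : nat => translate (h ^+ n)%g C)) ->
  irreducible rho.
Proof.
set C0 := coset 1%g => hfix hinj W [W0 WL] cW Wrho.
have {}W0 : W 0 by move: W0; rewrite in_setE.
have WZD a v w : W v -> W w -> W (a *: v + w).
  by move=> Wv Ww; have := WL a v w; rewrite !in_setE; exact.
have WZ a v : W v -> W (a *: v) by move=> Wv; rewrite -[_ *: _]addr0; exact: WZD.
have WD v w : W v -> W w -> W (v + w).
  by move=> Wv Ww; rewrite -[v]scale1r; exact: WZD.
have Wsum (I : Type) (r : seq I) F : (forall i, W (F i)) -> W (\sum_(i <- r) F i).
  by move=> WF; elim/big_rec: _ => // i v _; exact: WD.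
have [[w [Ww /eqP w0]]|nW] := pselect (exists w, W w /\ w <> 0); last first.
  left; apply/seteqP; split=> [w Ww|_ ->//].
  by apply: contrapT => w0; apply: nW; exists w.
right; apply/seteqP; split=> // v _.
have [C wC] : exists C, w C != 0.
  apply: contrapT => nC; case/eqP: w0; apply/val_inj/funext => C /=.
  by apply/eqP/negPn/negP => wC; apply: nC; exists C.
have [g Cg] := coset_surj C.
(* A nonzero value of [w] is moved to [C0] and normalised to 1. *)
pose w1 := (w C)^-1 *: rho g^-1%g w.
have Ww1 : W w1 by apply/WZ/Wrho.
have w1C0 : w1 C0 = 1.
  rewrite /w1 l2funZ /= invgK translate_coset mulg1 -Cg mulVf //.
have Wdelta0 : W (delta R C0).
  apply: closed_l2 cW _ => e e0.
  have [|N N0 hN] := @mean_quasiregular_small h C0 (delta R C0 - w1) e e0 hinj.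
    by rewrite l2funB w1C0 deltaE eqxx subrr.
  exists ((N%:R)^-1 *: \sum_(i < N) rho (h ^+ i)%g w1).
    by apply: WZ; apply: Wsum => i; exact: Wrho.
  (* The powers of [h] fix the point mass at [C0], which is therefore its own mean. *)
  suff <- : (N%:R)^-1 *: \sum_(i < N) rho (h ^+ i)%g (delta R C0 - w1) =
    delta R C0 - (N%:R)^-1 *: \sum_(i < N) rho (h ^+ i)%g w1 by [].
  have fixn i : translate (h ^+ i)%g C0 = C0.
    by elim: i => [|i IH]; rewrite ?expg0 ?translate1 // expgS translateM IH.
  under eq_bigr do rewrite linearB /= quasiregular_delta fixn.
  rewrite sumrB sumr_const card_ord scalerBr; congr (_ - _).
  rewrite -scalerMnr scalerMnl -mulr_natr mulVf ?scale1r // pnatr_eq0 -lt0n //.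
have Wdelta C' : W (delta R C').
  have [g' ->] := coset_surj C'.
  by rewrite -[g']mulg1 -translate_coset -quasiregular_delta; exact: Wrho.
apply: closed_l2 cW _ => e e0; have [s hs] := l2_approx v e0.
by exists (\sum_(x <- s) v x *: delta R x) => //; apply: Wsum => x; exact: WZ.
Qed.

End Irreducibility.

Lemma vecT_coset_fixed (R : realType) (h : thompson R) : vecT R h ->
  translate h (coset (vecT R) 1%g) = coset (vecT R) 1%g.
Proof.
move=> Hh; rewrite translate_coset mulg1.
apply/val_inj/seteqP; split=> _ [f Hf <-] /=.
  by exists (h * f)%g; [exact: vecTM|rewrite mul1g].
exists (h^-1 * f)%g; first by apply: vecTM => //; exact: vecTV.
by rewrite mulVKg mul1g.
Qed.

Lemma coset_vecT_eq (R : realType) (f g : thompson R) :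
  coset (vecT R) f = coset (vecT R) g -> vecT R (g^-1 * f)%g.
Proof.
move=> /(congr1 val)/= E.
have : ((fun h => (f * h)%g) @` vecT R) f by exists 1%g; [exact: vecT1|rewrite mulg1].
by rewrite E => -[h Hh <-]; rewrite mulKg.
Qed.

Theorem theorem6 (R : realType) : irreducible (quasiregular R (vecT R)).
Proof.
have [h hP] := exists_pushing R.
have Hh : vecT R h by apply/vecTP; exists false => y b; rewrite addbF; apply: hP.1.
apply: (@quasiregular_irreducible _ _ _ h); first exact: vecT_coset_fixed.
move=> C C0; have [g Cg] := coset_surj C; rewrite Cg in C0 *.
have Hg : ~ vecT R g.
  by move=> Hg; apply: C0; rewrite -(vecT_coset_fixed Hg) translate_coset mulg1.
(* Equal cosets would put [g^-1 * h ^+ (j - i) * g], with a positive exponent, in [vecT R], and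
   hence also [g]. *)
have lt_neq i j : (i < j)%N ->
    translate (h ^+ i)%g (coset (vecT R) g) <>
    translate (h ^+ j)%g (coset (vecT R) g).
  move=> ij /esym; rewrite !translate_coset => /coset_vecT_eq; rewrite invgM.
  rewrite -(subnKC ij) addSnnS expgnDr !mulgA mulgVK -[(_ * _ * g)%g]mulgA.
  by rewrite mulgA => /(conj_pushing_vecT hP).
move=> i j E; case: (ltngtP i j) => // ij; first by case: (lt_neq _ _ ij).
by case: (lt_neq _ _ ij).
Qed.
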